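(* Let $p,q\in(1,\infty)$ be such that $q>p/(p-1)$. Let $X$ be a Banach space with the $p$-alternating Banach-Saks property and with property $\mathcal{Q}_q$. Then $X$ is reflexive.
   Context: $p$-alternating Banach-Saks property: for $p\in(1,\infty)$ and $C>0$, $X$ has the $p$-alternating Banach-Saks property with constant $C$ if for all sequences $(x_n)_n$ in the closed unit ball $B_X$ and all $k\in\mathbb{N}$ there is an infinite $\mathbb{M}\subset\mathbb{N}$ such that $\big\|\sum_{j=1}^k(-1)^jx_{n_j}\big\|\le Ck^{1/p}$ for all $n_1<\dots<n_k$ in $\mathbb{M}$. $X$ has the $p$-alternating Banach-Saks property if it has it with some constant $C>0$. Interlaced graphs: $\mathbb{N}=\{1,2,\dots\}$. For $k\in\mathbb{N}$ and infinite $\mathbb{M}\subset\mathbb{N}$, $[\mathbb{M}]^k$ is the set of $k$-element subsets of $\mathbb{M}$, written as strictly increasing $k$-tuples. Two distinct $\overline n,\overline m\in[\mathbb{N}]^k$ are adjacent iff $n_1\le m_1\le n_2\le\dots\le n_k\le m_k$ or $m_1\le n_1\le m_2\le\dots\le m_k\le n_k$; $d_{\mathbb{K}}$ is the shortest path metric of this graph. Property $\mathcal{Q}_q$ ($q\in(1,\infty)$): $X$ has property $\mathcal{Q}_q$ if there is $C\ge1$ such that for every $k\in\mathbb{N}$ and every Lipschitz map $f:([\mathbb{N}]^k,d_{\mathbb{K}})\to X$ there is an infinite $\mathbb{M}\subset\mathbb{N}$ with $\|f(\overline n)-f(\overline m)\|\le C\,\omega_f(1)\,k^{1/q}$ for all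 $\overline n,\overline m\in[\mathbb{M}]^k$, where $\omega_f(1)=\sup\{\|f(\overline n)-f(\overline m)\|: d_{\mathbb{K}}(\overline n,\overline m)\le1\}$. *)

(* Defs.v *)
From HB Require Import structures.
From mathcomp Require Import all_boot all_order all_algebra.
From mathcomp Require Import all_classical all_reals all_analysis.

Set Implicit Arguments.
Unset Strict Implicit.
Unset Printing Implicit Defensive.

Import Order.TTheory GRing.Theory Num.Theory.
Import numFieldNormedType.Exports.

Local Open Scope classical_set_scope.
Local Open Scope ring_scope.

Section Dual.
Context (R : realType) (X : normedModType R).

Definition linear_continuous_pred : {pred X -> R^o} :=
  [pred f : X -> R^o | `[< linear f /\ continuous f >]].

Lemma linear_continuous_submod : submod_closed linear_continuous_pred.
Proof.
split=> [|a f g /asboolP[lf cf] /asboolP[lg cg]]; apply/asboolP; split.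
- by move=> b x y; rewrite /= scaler0 addr0.
- exact: cst_continuous.
- move=> b x y; rewrite !fctE lf lg !scalerDr !scalerA (mulrC b a).
  by rewrite -!addrA; congr (_ + _); rewrite addrCA.
- move=> x; apply: (@continuousD _ _ _ (a *: f) g).
  - exact: (continuousM (@cst_continuous _ _ a x) (cf x)).
  - exact: cg.
Qed.

HB.instance Definition _ := GRing.isSubmodClosed.Build _ _
  linear_continuous_pred linear_continuous_submod.

Definition dual : Type := {f : X -> R^o | f \in linear_continuous_pred}.

HB.instance Definition _ := SubChoice.on dual.
HB.instance Definition _ := [SubChoice_isSubLmodule of dual by <:].

Definition dual_fun (f : dual) : X -> R^o := val f.

Lemma dual_linear f : linear (dual_fun f).
Proof. by have /asboolP[] := valP f. Qed.

Lemma dual_continuous f : continuous (dual_fun f).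
Proof. by have /asboolP[] := valP f. Qed.

HB.instance Definition _ f := GRing.isLinear.Build R X R^o _ (dual_fun f)
  (@dual_linear f).

Definition dual_norm (f : dual) : R :=
  sup [set `|dual_fun f x| | x in [set x : X | `|x| <= 1]].

Lemma dual_norm_has_sup (f : dual) :
  has_sup [set `|dual_fun f x| | x in [set x : X | `|x| <= 1]].
Proof.
split; first by exists `|dual_fun f 0|, 0 => //=; rewrite normr0.
have /bounded_funP/(_ 1)[M fM] :=
  (linear_bounded_continuous (dual_fun f)).2 (@dual_continuous f).
by exists M => _ [x /= x1 <-]; exact: fM.
Qed.

Lemma dual_norm_ub (f : dual) x : `|dual_fun f x| <= dual_norm f * `|x|.
Proof.
have [->|x0] := eqVneq x 0; first by rewrite linear0 !normr0 mulr0.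
have nx0 : 0 < `|x| by rewrite normr_gt0.
rewrite -ler_pdivrMr// -[X in _ / X](@gtr0_norm _ `|x|)// -normf_div.
have -> : dual_fun f x / `|x| = dual_fun f (`|x|^-1 *: x).
  by rewrite linearZ /= mulrC.
apply: sup_upper_bound; first exact: dual_norm_has_sup.
exists (`|x|^-1 *: x) => //=.
by rewrite normrZ normfV normr_id mulVf ?gt_eqF.
Qed.

Lemma dual_norm_le (f : dual) (c : R) :
  (forall x, `|x| <= 1 -> `|dual_fun f x| <= c) -> dual_norm f <= c.
Proof.
move=> fc; apply: ge_sup; first by case: (dual_norm_has_sup f).
by move=> _ [x /= x1 <-]; exact: fc.
Qed.

Lemma dual_norm_ge0 (f : dual) : 0 <= dual_norm f.
Proof.
apply: le_trans (normr_ge0 (dual_fun f 0)) _.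
apply: sup_upper_bound; first exact: dual_norm_has_sup.
by exists 0 => //=; rewrite normr0.
Qed.

Let dual_norm_ub1 (f : dual) x : `|x| <= 1 -> `|dual_fun f x| <= dual_norm f.
Proof.
move=> x1; apply: le_trans (dual_norm_ub f x) _.
by rewrite ler_piMr// dual_norm_ge0.
Qed.

Lemma dual_normD (f g : dual) : dual_norm (f + g) <= dual_norm f + dual_norm g.
Proof.
apply: dual_norm_le => x x1; apply: le_trans (ler_normD _ _) _.
by apply: lerD; exact: dual_norm_ub1.
Qed.

Let dual_normZ_le a (f : dual) : dual_norm (a *: f) <= `|a| * dual_norm f.
Proof.
apply: dual_norm_le => x x1.
have -> : dual_fun (a *: f) x = a * dual_fun f x by [].
by rewrite normrM ler_wpM2l// dual_norm_ub1.
Qed.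

Lemma dual_normZ a (f : dual) : dual_norm (a *: f) = `|a| * dual_norm f.
Proof.
apply/eqP; rewrite eq_le dual_normZ_le/=.
have [->|a0] := eqVneq a 0; first by rewrite normr0 mul0r dual_norm_ge0.
rewrite mulrC -ler_pdivlMr ?normr_gt0// mulrC -normfV.
by apply: le_trans (dual_normZ_le _ _); rewrite scalerA mulVf// scale1r.
Qed.

Lemma dual_norm0_eq0 (f : dual) : dual_norm f = 0 -> f = 0.
Proof.
move=> f0; apply/val_inj/funext => x; apply/eqP.
by rewrite -[_ == _]normr_le0 (le_trans (dual_norm_ub f x))// f0 mul0r.
Qed.

HB.instance Definition _ := Lmodule_isNormed.Build R dual
  dual_normD dual_normZ dual_norm0_eq0.

End Dual.

Arguments linear_continuous_pred {R} X.

Section Reflexive.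
Context (R : realType) (X : normedModType R).

Lemma eval_linear_continuous (x : X) :
  (fun f : dual X => dual_fun f x) \in linear_continuous_pred (dual X).
Proof.
have lx : linear (fun f : dual X => dual_fun f x : R^o) by [].
apply/asboolP; split=> //.
pose L := GRing.isLinear.Build R (dual X) R^o _ _ lx.
pose ev : {linear dual X -> R^o} := HB.pack (fun f : dual X => dual_fun f x) L.
apply/(linear_bounded_continuous ev)/bounded_funP => r.
exists (r * `|x|) => f fr /=; apply: le_trans (dual_norm_ub f x) _.
by rewrite ler_wpM2r.
Qed.

Definition canonical_embedding (x : X) : dual (dual X) :=
  Sub (fun f : dual X => dual_fun f x) (eval_linear_continuous x).

Definition reflexive_space : Prop :=
  forall phi : dual (dual X), exists x : X, canonical_embedding x = phi.

End Reflexive.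

(* The type [N]^k, with nat standing for the index set {1, 2, ...}: only the
   order of the indices matters, so starting at 0 is a mere relabelling. *)
Record ksubset (k : nat) := KSubset {
  ktuple :> k.-tuple nat ;
  ktuple_sorted : sorted ltn ktuple }.

HB.instance Definition _ k := [isSub for @ktuple k].
HB.instance Definition _ k := [Choice of ksubset k by <:].

Definition ksubset_of (M : set nat) (k : nat) : set (ksubset k) :=
  [set n | forall i, M (tnth n i)].

Section Interlaced.
Context (k : nat).
Implicit Types n m : ksubset k.

(* n_1 <= m_1 <= n_2 <= m_2 <= ... <= n_k <= m_k *)
Definition interlace n m : bool :=
  [forall i, (tnth n i <= tnth m i)%N] &&
  [forall i, forall j : 'I_k,
     (val j == (val i).+1) ==> (tnth m i <= tnth n j)%N].

Definition interlaced_adj : rel (ksubset k) :=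
  fun n m => (n != m) && (interlace n m || interlace m n).

Definition walk n m (l : nat) : Prop :=
  exists s, [/\ path interlaced_adj n s, last n s = m & size s = l].

Let linked n m := exists l, walk n m l.

Let linked_trans n1 n2 n3 : linked n1 n2 -> linked n2 n3 -> linked n1 n3.
Proof.
move=> [_ [s [ps <- _]]] [_ [t [pt <- _]]]; exists (size (s ++ t)), (s ++ t).
by rewrite cat_path last_cat ps pt.
Qed.

Let interlace_linked n m : interlace n m || interlace m n -> linked n m.
Proof.
move=> nm; have [->|neq] := eqVneq n m; first by exists 0%N, [::].
by exists 1%N, [:: m]; split=> //=; rewrite /interlaced_adj neq nm.
Qed.

Let linked_sym n m : linked n m -> linked m n.
Proof.
move=> [_ [s [+ + _]]]; elim: s n => [|a s IH] n /=.
  by move=> _ ->; exists 0%N, [::].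
move=> /andP[/andP[_ na] ps] lm; apply: linked_trans (IH _ ps lm) _.
by apply: interlace_linked; rewrite orbC.
Qed.

Let window_sorted (u : nat -> nat) (hu : {homo u : i j / (i < j)%N}) j :
  sorted ltn [tuple u (j + i)%N | i < k].
Proof.
rewrite /= (_ : [seq _ | i <- _] = map (fun i => u (j + i)%N) (iota 0 k)).
  by rewrite sorted_map; apply: sub_sorted (iota_ltn_sorted 0 k) => a b ab;
     apply: hu; rewrite ltn_add2l.
by rewrite -val_enum_ord -map_comp.
Qed.

Let window u hu j := KSubset (@window_sorted u hu j).

Let linked_window u hu j : linked (@window u hu 0) (@window u hu j).
Proof.
elim: j => [|j IH]; first by exists 0%N, [::].
apply: linked_trans IH _; apply: interlace_linked; apply/orP; left.
apply/andP; split; apply/forallP => i; first by rewrite !tnth_mktuple ltnW ?hu.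
apply/forallP => i'; apply/implyP => /eqP ii'; rewrite !tnth_mktuple/=.
by rewrite [val i']ii' addSnnS.
Qed.

Let linked_far n (N : nat) : (forall i, tnth n i < N)%N ->
  exists2 m, linked n m & forall i, tnth m i = (N + (k + i))%N.
Proof.
move=> nN; pose u i := if (i < k)%N then nth 0%N n i else (N + i)%N.
have hu : {homo u : i j / (i < j)%N}.
  move=> i j ij; rewrite /u; case: (ltnP j k) => jk.
    rewrite (ltn_trans ij jk) (sorted_ltn_nth ltn_trans) ?ktuple_sorted//.
      by rewrite inE size_tuple (ltn_trans ij).
    by rewrite inE size_tuple.
  case: (ltnP i k) => ik; last by rewrite ltn_add2l.
  have := nN (Ordinal ik); rewrite (tnth_nth 0%N)/= => /leq_trans; apply.
  exact: leq_addr.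
exists (window hu k); last first.
  by move=> i; rewrite tnth_mktuple /u ltnNge leq_addr.
have -> : n = window hu 0; last exact: linked_window.
apply/val_inj/eq_from_tnth => i.
by rewrite tnth_mktuple /u add0n ltn_ord (tnth_nth 0%N).
Qed.

Lemma interlaced_connected n m : exists l, `[< walk n m l >].
Proof.
pose N := (\max_i tnth n i + \max_i tnth m i).+1.
have [n' nn' n'E] : exists2 m, linked n m & forall i, tnth m i = (N + (k + i))%N.
  by apply: linked_far => i; rewrite ltnS (leq_trans (leq_bigmax i))// leq_addr.
have [m' mm' m'E] : exists2 n, linked m n & forall i, tnth n i = (N + (k + i))%N.
  apply: linked_far => i.
  by rewrite ltnS (leq_trans (leq_bigmax i))// leq_addl.
have nm' : n' = m' by apply/val_inj/eq_from_tnth => i; rewrite n'E m'E.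
have [l nml] : linked n m.
  by apply: linked_trans nn' _; rewrite nm'; exact: linked_sym.
by exists l; apply/asboolP.
Qed.

Definition interlaced_dist n m : nat := ex_minn (interlaced_connected n m).

End Interlaced.

Section Properties.
Context (R : realType) (X : normedModType R).

Definition interlaced_lipschitz k (f : ksubset k -> X) : Prop :=
  exists L : R, forall n m, `|f n - f m| <= L * (interlaced_dist n m)%:R.

(* omega_f(t) = sup {|f n - f m| : d(n, m) <= t}; the supremum is over a
   nonempty set, bounded as soon as f is Lipschitz. *)
Definition modulus k (f : ksubset k -> X) (t : R) : R :=
  sup [set `|f nm.1 - f nm.2| |
       nm in [set nm : ksubset k * ksubset k |
              (interlaced_dist nm.1 nm.2)%:R <= t]].

(* The index j : 'I_k is one less than the index of the k-tuple entry it
   refers to, hence the exponent j.+1. *)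
Definition alternating_banach_saks_with (p C : R) : Prop :=
  forall x : nat -> X, (forall i, `|x i| <= 1) ->
  forall k, (0 < k)%N ->
  exists2 M : set nat, infinite_set M &
    forall n : ksubset k, ksubset_of M n ->
      `|\sum_(j < k) (-1) ^+ j.+1 *: x (tnth n j)| <= C * k%:R `^ p^-1.

Definition alternating_banach_saks (p : R) : Prop :=
  exists2 C : R, 0 < C & alternating_banach_saks_with p C.

Definition property_Q (q : R) : Prop :=
  exists2 C : R, 1 <= C &
    forall k, (0 < k)%N ->
    forall f : ksubset k -> X, interlaced_lipschitz f ->
    exists2 M : set nat, infinite_set M &
      forall n m : ksubset k, ksubset_of M n -> ksubset_of M m ->
        `|f n - f m| <= C * modulus f 1 * k%:R `^ q^-1.

End Properties.

(* Main.v *)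
From HB Require Import structures.
Require Import Defs.
From mathcomp Require Import all_boot all_order all_algebra.
From mathcomp Require Import all_classical all_reals all_analysis.
From mathcomp Require Import ring lra zify.

Import Order.TTheory GRing.Theory Num.Theory.
Import numFieldNormedType.Exports.
Local Open Scope ring_scope.

(** Suppose that [X] is not reflexive. The canonical image of [X] in its bidual
    is closed ([canonical_embedding_closed]; this is where completeness and a
    Hahn-Banach theorem enter), so some [psi] in the unit ball of the bidual
    stays at distance more than some [d > 0] from it.

    For each [k], such a [psi] produces a sequence [x] in the unit ball such
    that any [k] terms and any [k] later terms have sums at distance at least
    [k * d / 2] ([exists_separated_sequence]). This is a finitary form of James'
    criterion. By definition of the norm of the bidual, each average [u] of
    earlier terms comes with a functional [f] of norm at most 1 for which
    [psi f - f u > d]; only finitely many averages are present at each stage, so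
    Goldstine's theorem for finitely many functionals ([finite_goldstine])
    gives a next term [y] at which [f y] is close to [psi f] for all of them.

    On the other hand, pass to a subsequence on which alternating sums of length
    [2 * k] have norm at most [B = C (2k)^(1/p)], and send a [k]-subset [n] to
    the sum of the [x] at places [2k * n_j + 2j]. These places are so sparse that for
    interlaced [n <= m] there is room for a set of intermediate places
    interlacing strictly with those of [n] and with those of [m], whence two
    alternating sums of length exactly [2 * k] bound the difference of the
    images by [2B]; entries that [n] and [m] share need no separate treatment.
    Property Q of exponent [q] then gives two [k]-subsets, one entirely before
    the other, whose images are at distance at most a constant times
    [k^(1/p + 1/q)] ([separation_le]). Since [q > p / (p - 1)] means
    [1/p + 1/q < 1], this is less than [k * d / 2] for large [k]. *)

(** * Sublinear functionals and a Hahn-Banach theorem *)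

Section SublinearFunctionals.
Context {R : realType} {V : lmodType R}.
Implicit Types (p q : V -> R) (F : set (V -> R)).

(** Only one inequality is asked of homogeneity, because infima of families
    satisfy it readily; the converse inequality follows by applying it to the
    inverse scalar. *)
Definition sublinear p : Prop :=
  (forall x y, p (x + y) <= p x + p y) /\
  (forall t x, 0 < t -> p (t *: x) <= t * p x).

Lemma sublinear0 p : sublinear p -> p 0 = 0.
Proof.
move=> [_ ph]; have := ph 2 0 (ltr0n _ 2); have := ph 2^-1 0.
rewrite !scaler0 invr_gt0 ltr0n => /(_ isT); lra.
Qed.

Lemma sublinear_lower p x y : sublinear p -> p x - p (- y) <= p (x + y).
Proof. by move=> [pD _]; rewrite lerBlDr -{1}(addrK y x) pD. Qed.

Lemma sublinearN p x : sublinear p -> - p (- x) <= p x.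
Proof.
by move=> sp; have := sublinear_lower _ 0 x sp; rewrite sublinear0// !add0r.
Qed.

Definition pointwise_inf F (x : V) : R := inf [set f x | f in F].

Lemma pointwise_inf_le {F} {l : V -> R} {f} x :
  (forall g y, F g -> l y <= g y) -> F f -> pointwise_inf F x <= f x.
Proof.
move=> lF Ff; apply: ge_inf; last by exists f.
by exists (l x) => _ [g Fg <-]; exact: lF.
Qed.

Lemma le_pointwise_inf F x r : (F !=set0)%classic ->
  (forall f, F f -> r <= f x) -> r <= pointwise_inf F x.
Proof.
move=> [f Ff] rF; apply: lb_le_inf; first by exists (f x), f.
by move=> _ [g Fg <-]; exact: rF.
Qed.

(** Directedness of the family up to the algebraic operations is what makes the
    infimum sublinear. It covers both chains, for Zorn's lemma, and the family
    defining [tilt] below. *)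
Lemma sublinear_pointwise_inf F (l : V -> R) : (F !=set0)%classic ->
  (forall f x, F f -> l x <= f x) ->
  (forall f g x y, F f -> F g -> exists2 h, F h & h (x + y) <= f x + g y) ->
  (forall f t x, F f -> 0 < t -> exists2 h, F h & h (t *: x) <= t * f x) ->
  sublinear (pointwise_inf F).
Proof.
move=> F0 lF FD FZ; split=> [x y|t x t0].
  rewrite -lerBlDr; apply: le_pointwise_inf => // f Ff.
  rewrite lerBlDr -lerBlDl; apply: le_pointwise_inf => // g Fg.
  rewrite lerBlDl; have [h Fh] := FD _ _ x y Ff Fg; apply: le_trans.
  exact: pointwise_inf_le lF Fh.
rewrite mulrC -ler_pdivrMr//; apply: le_pointwise_inf => // f Ff.
rewrite ler_pdivrMr// mulrC; have [h Fh] := FZ _ _ x Ff t0; apply: le_trans.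
exact: pointwise_inf_le lF Fh.
Qed.

(** The largest sublinear functional below [p] whose value at [- y] is at most
    [- p y]; it serves to make [p] additive in the direction [y]. *)
Definition tilt p y : V -> R :=
  pointwise_inf
    [set (fun x => p (x + t *: y) - t * p y) | t in [set t | 0 <= t]].

Section Tilt.
Context {p} (sp : sublinear p) (y : V).

Let tilt_lower (f : V -> R) x :
  [set (fun x => p (x + t *: y) - t * p y) | t in [set t | 0 <= t]]%classic f ->
  - p (- x) <= f x.
Proof.
move=> [t /= t0 <-]; have := sublinear_lower _ (t *: y) x sp.
rewrite (addrC (_ *: _)).
suff: p (t *: y) = t * p y by lra.
have [->|tN0] := eqVneq t 0; first by rewrite scale0r sublinear0// mul0r.
have {t0 tN0}t0 : 0 < t by rewrite lt0r tN0.
have [_ ph] := sp; apply/eqP; rewrite eq_le ph//=.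
have := ph t^-1 (t *: y); rewrite invr_gt0 => /(_ t0).
by rewrite scalerA mulVf ?gt_eqF// scale1r ler_pdivlMl.
Qed.

Lemma sublinear_tilt : sublinear (tilt p y).
Proof.
have [pD pZ] := sp; apply: sublinear_pointwise_inf.
- by eexists; exists 0 => /=.
- by move=> f x; exact: tilt_lower.
- move=> _ _ x x' [s /= s0 <-] [t /= t0 <-]; eexists.
    by exists (s + t) => //=; exact: addr_ge0.
  by rewrite scalerDl addrACA (le_trans (lerB (pD _ _) (lexx _)))// mulrDl; lra.
- move=> _ s x [t /= t0 <-] s0; eexists.
    by exists (s * t) => //=; rewrite mulr_ge0// ltW.
  by rewrite -scalerA -scalerDr mulrBr -mulrA lerB// pZ.
Qed.

Let tilt_le_at t x : 0 <= t -> tilt p y x <= p (x + t *: y) - t * p y.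
Proof.
move=> t0; pose f x := p (x + t *: y) - t * p y.
apply: (@pointwise_inf_le _ (fun x => - p (- x)) f); last by exists t.
by move=> g z; exact: tilt_lower.
Qed.

Lemma tilt_le x : tilt p y x <= p x.
Proof.
by have := tilt_le_at _ x (lexx 0); rewrite scale0r addr0 mul0r subr0.
Qed.

Lemma tiltN : tilt p y (- y) <= - p y.
Proof.
have := tilt_le_at _ (- y) ler01.
by rewrite scale1r addNr sublinear0// sub0r mul1r.
Qed.

End Tilt.

(** Zorn's lemma for the reverse pointwise order. The infimum of a chain exists
    because every sublinear [f] below [p] satisfies [f x >= - p (- x)]. *)
Lemma exists_minimal_sublinear p : sublinear p ->
  exists q, [/\ sublinear q, forall x, q x <= p x &
    forall r, sublinear r -> (forall x, r x <= q x) -> forall x, q x <= r x].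
Proof.
move=> sp.
pose T := {q : V -> R | sublinear q /\ forall x, q x <= p x}.
pose below (f g : T) := `[< forall x, sval g x <= sval f x >].
have p0 : T by exists p.
have [|f g h /asboolP fg /asboolP gh|A totA|] := @ZL_preorder T p0 below.
- by move=> f; apply/asboolP => x.
- by apply/asboolP => x; exact: le_trans (gh x) (fg x).
- have [A0|/set0P[a Aa]] := eqVneq A set0; first by exists p0 => s; rewrite A0.
  pose F := [set sval f | f in A]%classic.
  have Fl g x : F g -> - p (- x) <= g x.
    move=> [f Af <-]; have [sf fp] := svalP f.
    by apply: le_trans (sublinearN _ x sf); rewrite lerN2.
  have F0 : (F !=set0)%classic by exists (sval a), a.
  have sF : sublinear (pointwise_inf F).
    apply: (@sublinear_pointwise_inf F (fun x => - p (- x))) => //.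
    - move=> _ _ x y [f Af <-] [g Ag <-].
      have [sf _] := svalP f; have [sg _] := svalP g.
      have [/asboolP fg|/asboolP gf] := totA _ _ Af Ag.
        exists (sval g); first by exists g.
        by apply: le_trans (sg.1 _ _) _; rewrite lerD2r.
      exists (sval f); first by exists f.
      by apply: le_trans (sf.1 _ _) _; rewrite lerD2l.
    - move=> _ t x [f Af <-] t0; exists (sval f); first by exists f.
      by have [[_ fZ] _] := svalP f; exact: fZ.
  have lep x : pointwise_inf F x <= p x.
    apply: (@le_trans _ _ (sval a x)); last by have [] := svalP a.
    by apply: (pointwise_inf_le _ Fl); exists a.
  exists (exist _ (pointwise_inf F) (conj sF lep)) => s As.
  apply/asboolP => x /=.
  by apply: (pointwise_inf_le _ Fl); exists s.
- move=> [q [sq qp]] qmin; exists q; split=> // r sr rq x.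
  have rp z : r z <= p z by exact: le_trans (rq z) (qp z).
  have /asboolP := qmin (exist _ r (conj sr rp)) (introT (asboolP _) rq).
  exact.
Qed.

(** Minimality forces [q] below each of its tilts, so [q] is odd, and an odd
    sublinear functional is linear. *)
Lemma minimal_sublinear_linear q : sublinear q ->
  (forall r, sublinear r -> (forall x, r x <= q x) -> forall x, q x <= r x) ->
  linear (q : V -> R^o).
Proof.
move=> sq qmin; have [qD qZ] := sq.
have qN x : q (- x) = - q x.
  apply/eqP; rewrite eq_le; apply/andP; split.
    apply: le_trans (tiltN sq x); apply: qmin; first exact: sublinear_tilt.
    exact: tilt_le.
  by have := sublinearN _ (- x) sq; rewrite opprK.
have qDE x y : q (x + y) = q x + q y.
  apply/eqP; rewrite eq_le qD/=; have := sublinear_lower _ x y sq.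
  by rewrite qN opprK.
have qpZ t x : 0 < t -> q (t *: x) = t * q x.
  move=> t0; apply/eqP; rewrite eq_le qZ//=.
  by have := qZ t (- x) t0; rewrite scalerN !qN mulrN lerN2.
move=> a x y; rewrite qDE; congr (_ + _).
suff: q (a *: x) = a * q x by [].
have [a0|a0|->] := ltgtP a 0; last by rewrite scale0r sublinear0// mul0r.
  by have := qpZ (- a) x; rewrite oppr_gt0 scaleNr qN mulNr => /(_ a0)/oppr_inj.
exact: qpZ.
Qed.

Lemma exists_linear_le_sublinear p : sublinear p ->
  exists2 f : V -> R, linear (f : V -> R^o) & forall x, f x <= p x.
Proof.
by move=> /exists_minimal_sublinear[q [sq qp /minimal_sublinear_linear]];
   exists q => //; auto.
Qed.

End SublinearFunctionals.

(** * The bidual: closed canonical image and a finite Goldstine theorem *)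

Section Duality.
Context {R : realType} {X : normedModType R}.
Implicit Types (x y : X) (f : dual X) (phi : dual (dual X)).

Lemma exists_dual (f : X -> R) (M : R) : linear (f : X -> R^o) ->
  (forall x, `|f x| <= M * `|x|) -> exists g : dual X, dual_fun g = f.
Proof.
move=> lf fM.
pose L := GRing.isLinear.Build R X R^o _ (f : X -> R^o) lf.
pose l : {linear X -> R^o} := HB.pack (f : X -> R^o) L.
have cf : continuous (f : X -> R^o).
  apply/(linear_bounded_continuous l)/bounded_funP => r.
  exists (`|M| * r) => x xr; apply: le_trans (fM x) _.
  apply: le_trans (ler_wpM2l (normr_ge0 M) xr).
  by rewrite ler_wpM2r// ler_norm.
have fP : (f : X -> R^o) \in linear_continuous_pred X by apply/asboolP; split.
by exists (Sub (f : X -> R^o) fP).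
Qed.

Lemma sublinear_norm : sublinear (fun x : X => `|x|).
Proof.
by split=> [x y|t x t0]; [exact: ler_normD | rewrite normrZ gtr0_norm].
Qed.

(** A linear functional below the norm tilted in the direction [x] is below the
    norm, and its value at [- x] is at most [- `|x|]. *)
Lemma exists_norming x :
  exists2 f : dual X, dual_norm f <= 1 & dual_fun f x = `|x|.
Proof.
have sn := sublinear_norm.
have [f lf fle] := exists_linear_le_sublinear _ (sublinear_tilt sn x).
have fn y : f y <= `|y| by exact: le_trans (fle y) (tilt_le sn x y).
have fN y : f (- y) = - f y.
  have f0 : f 0 = 0.
    by have := lf (-1) 0 0; rewrite scaleN1r addNr scaleN1r addNr.
  by have := lf (-1) y 0; rewrite f0 !addr0 !scaleN1r.
have fabs y : `|f y| <= 1 * `|y|.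
  by rewrite mul1r ler_norml fn andbT lerNl -fN (le_trans (fn _)) ?normrN.
have [g gf] := exists_dual f 1 lf fabs.
exists g.
  by apply: dual_norm_le => y y1; rewrite gf (le_trans (fabs y))// mul1r.
apply/eqP; rewrite gf eq_le fn/= -lerN2 -fN.
by apply: le_trans (fle _) _; exact: tiltN.
Qed.

Lemma canonical_embeddingB x y :
  canonical_embedding (x - y) = canonical_embedding x - canonical_embedding y.
Proof. by apply/val_inj/funext => f; exact: (linearB (dual_fun f)). Qed.

Lemma canonical_embeddingZ t x :
  canonical_embedding (t *: x) = t *: canonical_embedding x.
Proof. by apply/val_inj/funext => f; rewrite /= linearZ. Qed.

Lemma norm_canonical_embedding x : `|canonical_embedding x| = `|x|.
Proof.
apply/eqP; rewrite eq_le; apply/andP; split.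
  apply: dual_norm_le => f f1; apply: le_trans (dual_norm_ub f x) _.
  by rewrite ler_piMl.
have [f f1 fx] := exists_norming x.
rewrite -fx; apply: le_trans (ler_norm _) _.
apply: le_trans (dual_norm_ub (canonical_embedding x) f) _.
by rewrite ler_piMr// dual_norm_ge0.
Qed.

End Duality.

(** The embedding is isometric, so approximate preimages of [phi] form a Cauchy
    sequence. *)
Lemma canonical_embedding_closed {R : realType} {X : completeNormedModType R}
    (phi : dual (dual X)) :
  (forall e, 0 < e -> exists x, `|phi - canonical_embedding x| < e) ->
  exists x, canonical_embedding x = phi.
Proof.
move=> phie.
have /choice[u uP] n : exists x, `|phi - canonical_embedding x| < n.+1%:R^-1.
  by apply: phie; rewrite invr_gt0.
have uB x n : `|x - u n| <= `|phi - canonical_embedding x| + n.+1%:R^-1.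
  rewrite -norm_canonical_embedding canonical_embeddingB.
  apply: le_trans (ler_distD phi _ _) _.
  by rewrite distrC lerD2l ltW.
have : cauchy (u @ \oo)%classic.
  apply: cauchy_exP => e e0.
  have [N _ NP] := near_infty_natSinv_lt (PosNum (divr_gt0 e0 (ltr0n _ 2))).
  exists (u N); exists N => // n /= Nn; rewrite -ball_normE /=.
  apply: le_lt_trans (uB _ _) _; rewrite (splitr e) ltrD//; last exact: NP.
  exact: lt_trans (uP N) (NP _ (leqnn N)).
move=> /cauchy_cvg/cvg_ex[l /cvgrPdist_lt ul]; exists l; apply/esym/eqP.
rewrite -subr_eq0 -normr_le0; apply/ler_addgt0Pr => e e0; rewrite add0r.
have e20 := divr_gt0 e0 (ltr0n R 2).
near \oo%classic => n.
apply: le_trans (ler_distD (canonical_embedding (u n)) _ _) _.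
rewrite -canonical_embeddingB norm_canonical_embedding (splitr e).
apply: lerD; last by rewrite distrC ltW//; near: n; exact: ul.
rewrite (le_trans (ltW (uP n)))// ltW//.
near: n; exact: (near_infty_natSinv_lt (PosNum e20)).
Unshelve. all: by end_near. Qed.

(** A variational argument replaces the separation theorem. If the sum [D] of
    the squared defects had a positive infimum [d] on the unit ball, take a near
    minimizer [x] and let [g] combine the functionals with their defects at [x]
    as coefficients. Moving slightly from [x] towards any [y] of the unit ball
    cannot decrease [D] below [d], which bounds [g y], hence the norm of [g], by
    [g x + d / 2]; whereas [phi g = D x + g x] is at least [g x + d]. *)
Lemma finite_goldstine {R : realType} {X : normedModType R}
    (phi : dual (dual X)) (fs : seq (dual X)) (e : R) :
  `|phi| <= 1 -> 0 < e ->
  exists2 x : X, `|x| <= 1 &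
    forall f, f \in fs -> `|dual_fun f x - dual_fun phi f| < e.
Proof.
move=> phi1 e0.
pose D x : R := \sum_(f <- fs) (dual_fun phi f - dual_fun f x : R) ^+ 2.
have D0 x : 0 <= D x by apply: sumr_ge0 => f _; exact: sqr_ge0.
pose S := [set D x | x in [set x : X | `|x| <= 1]]%classic.
have S0 : has_inf S.
  split; first by exists (D 0), 0 => //=; rewrite normr0.
  by exists 0 => _ [x _ <-].
have dD x : `|x| <= 1 -> inf S <= D x.
  by move=> x1; apply: ge_inf; [case: S0 | exists x].
suff : inf S <= 0.
  move=> d0; have [_ [x x1 <-] Dx] := inf_adherent (exprn_gt0 2 e0) S0.
  exists x => // f ffs; rewrite distrC -(@ltr_pXn2r _ 2)// ?nnegrE ?ltW//.
  rewrite -normrX ger0_norm ?sqr_ge0//.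
  apply: le_lt_trans (lt_le_trans Dx _); last by rewrite gerDr.
  rewrite /D (big_rem f)//= lerDl; apply: sumr_ge0 => g _; exact: sqr_ge0.
rewrite leNgt; apply/negP => d0; set d := inf S in dD d0.
pose M := \sum_(f <- fs) (dual_norm f * 2) ^+ 2.
have M0 : 0 <= M by apply: sumr_ge0 => f _; exact: sqr_ge0.
(* the step length: at most 1 to stay in the ball, and short enough for the
   quadratic term t * M to take up only half of d *)
pose t := d / (d + 2 * M).
have t0 : 0 < t by rewrite divr_gt0// ltr_wpDr// mulr_ge0.
have t1 : t <= 1 by rewrite ler_pdivrMr ?ltr_wpDr// ?mul1r ?lerDl mulr_ge0.
have tM : t * M <= d / 2.
  rewrite /t mulrAC ler_pdivrMr ?ltr_wpDr ?mulr_ge0//; nra.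
have [_ [x x1 <-] Dx] :=
  inf_adherent (mulr_gt0 t0 (divr_gt0 d0 (ltr0n R 2))) S0.
clearbody t; pose r f : R := dual_fun phi f - dual_fun f x.
pose g : dual X := \sum_(f <- fs) r f *: f.
have gE y : dual_fun g y = \sum_(f <- fs) r f * dual_fun f y.
  rewrite -[LHS]/(dual_fun (canonical_embedding y) g) raddf_sum.
  by apply: eq_bigr.
have phigE : dual_fun phi g = D x + dual_fun g x.
  rewrite gE -big_split raddf_sum; apply: eq_bigr => f _; rewrite /= linearZ/=.
  rewrite -/(r f) /GRing.scale/= expr2 -mulrDr; congr (_ * _).
  by rewrite /r subrK.
have gle y : `|y| <= 1 -> dual_fun g y <= dual_fun g x + d / 2.
  move=> y1; pose z := x + t *: (y - x).
  have z1 : `|z| <= 1.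
    have -> : z = (1 - t) *: x + t *: y.
      by rewrite /z scalerBr scalerBl scale1r -addrA (addrC (- _)).
    apply: le_trans (ler_normD _ _) _.
    rewrite !normrZ !ger0_norm ?subr_ge0 ?(ltW t0)//.
    apply: (@le_trans _ _ (1 - t + t)); last by rewrite subrK.
    by rewrite lerD// ler_piMr ?subr_ge0// ltW.
  have DzE : D z = D x - 2 * t * dual_fun g (y - x)
      + t ^+ 2 * \sum_(f <- fs) dual_fun f (y - x) ^+ 2.
    rewrite gE !mulr_sumr -sumrN -!big_split; apply: eq_bigr => f _ /=.
    have -> : dual_fun f z = dual_fun f x + t * dual_fun f (y - x).
      by rewrite /z linearD /= linearZ.
    by rewrite /r; ring.
  have yxM : \sum_(f <- fs) dual_fun f (y - x) ^+ 2 <= M.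
    apply: ler_sum => f _; rewrite -[_ ^+ 2]ger0_norm ?sqr_ge0// normrX.
    rewrite ler_pXn2r ?nnegrE ?mulr_ge0 ?dual_norm_ge0//.
    apply: le_trans (dual_norm_ub _ _) _; rewrite ler_wpM2l ?dual_norm_ge0//.
    by apply: le_trans (ler_normB _ _) _; exact: lerD y1 x1.
  have := dD z z1; rewrite DzE linearB /= => dz.
  have : 2 * (dual_fun g y - dual_fun g x) * t <= (d / 2 + t * M) * t.
    have : t ^+ 2 * \sum_(f <- fs) dual_fun f (y - x) ^+ 2 <= t ^+ 2 * M.
      by rewrite ler_wpM2l ?sqr_ge0.
    lra.
  by rewrite ler_pM2r//; lra.
have gnorm : dual_norm g <= dual_fun g x + d / 2.
  apply: dual_norm_le => y y1; rewrite ler_norml gle// andbT lerNl.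
  by have := gle (- y); rewrite normrN linearN; exact.
have : dual_fun phi g <= dual_norm g.
  apply: le_trans (ler_norm _) _; apply: le_trans (dual_norm_ub _ _) _.
  by rewrite ler_piMl ?dual_norm_ge0.
by have := dD x x1; lra.
Qed.

(** * Separated sequences from a functional outside the canonical image *)

Section SeparatedSequence.
Context {R : realType} {X : normedModType R}.

(** All sums of [k] entries of [w], repetitions allowed: a finite list that
    contains every [k]-term sum of an initial segment. *)
Fixpoint sums (k : nat) (w : seq X) : seq X :=
  if k is k'.+1 then [seq x + s | x <- w, s <- sums k' w] else [:: 0].

Lemma mem_sums k (x : nat -> X) N (a : 'I_k -> nat) : (forall i, (a i < N)%N) ->
  \sum_(i < k) x (a i) \in sums k (mkseq x N).
Proof.
elim: k a => [a _|k IH a aN]; first by rewrite big_ord0 inE.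
rewrite big_ord_recl; apply: allpairs_f.
  by rewrite map_f// mem_iota add0n aN.
by apply: IH => i; exact: aN.
Qed.

Lemma exists_history_sequence (P : seq X -> X -> Prop) :
  (forall w, exists x, P w x) ->
  exists x : nat -> X, forall n, P (mkseq x n) (x n).
Proof.
move=> /choice[next nextP].
pose w n := iter n (fun w => rcons w (next w)) [::].
exists (next \o w) => n.
suff -> : mkseq (next \o w) n = w n by exact: nextP.
by elim: n => // n IH; rewrite mkseqS IH.
Qed.

Lemma exists_separating_functional (phi : dual (dual X)) (d : R) (u : X) :
  d < `|phi - canonical_embedding u| ->
  exists2 f : dual X, dual_norm f <= 1 & d < dual_fun phi f - dual_fun f u.
Proof.
move=> dphi; have [|_ [f f1 <-]] := sup_gt _ dphi.
  exists `|dual_fun (phi - canonical_embedding u) 0|, 0 => //=.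
  by rewrite normr0.
have -> : dual_fun (phi - canonical_embedding u) f
  = dual_fun phi f - dual_fun f u by [].
have [_ df|_ df] := ger0P (dual_fun phi f - dual_fun f u); first by exists f.
exists (- f); first by rewrite -[dual_norm _]/(`|- f|) normrN.
rewrite linearN /=.
have -> : dual_fun (- f) u = - dual_fun f u by [].
by rewrite -opprD.
Qed.

(** [G u] is a functional separating [phi] from [u / k], where [u] is a sum of
    [k] earlier terms. All later terms have [G u]-value above
    [phi (G u) - d / 2], while the average [u / k] has [G u]-value below
    [phi (G u) - d]. The gap does not depend on [k]. *)
Lemma exists_separated_sequence (phi : dual (dual X)) (d : R) (k : nat) :
  0 < d -> `|phi| <= 1 -> (forall x, d < `|phi - canonical_embedding x|) ->
  exists2 x : nat -> X, forall i, `|x i| <= 1 &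
    forall a b : 'I_k -> nat, (forall i j, (a i < b j)%N) ->
      k%:R * (d / 2) <= `|\sum_(i < k) x (b i) - \sum_(i < k) x (a i)|.
Proof.
move=> d0 phi1 dphi; case: k => [|k].
  by exists (fun=> 0) => [i|a b _]; rewrite ?normr0// mul0r.
have /choice[F FP] u : exists f : dual X,
    dual_norm f <= 1 /\ d < dual_fun phi f - dual_fun f u.
  by have [f] := exists_separating_functional phi d u (dphi u); exists f.
pose G (u : X) := F (k.+1%:R^-1 *: u).
have d20 : 0 < d / 2 by rewrite divr_gt0.
have [x xP] := exists_history_sequence (fun w y => `|y| <= 1 /\
    forall f, f \in map G (sums k.+1 w) ->
      `|dual_fun f y - dual_fun phi f| < d / 2)
  (fun w => let: ex_intro2 y y1 yP :=
    finite_goldstine phi (map G (sums k.+1 w)) (d / 2) phi1 d20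
    in ex_intro _ y (conj y1 yP)).
exists x => [i|a b ab]; first by have [] := xP i.
set u := \sum_(i < _) x (a i); have [Gu1 dGu] := FP (k.+1%:R^-1 *: u).
rewrite -/(G u) in Gu1 dGu.
have phiG j : dual_fun phi (G u) - d / 2 <= dual_fun (G u) (x (b j)).
  have [_ /(_ (G u))] := xP (b j).
  rewrite map_f; last by apply: mem_sums => i.
  by move=> /(_ isT); rewrite ltr_norml => /andP[+ _]; lra.
apply: le_trans (_ : dual_fun (G u) (\sum_(i < k.+1) x (b i) - u) <= _);
  last first.
  apply: le_trans (ler_norm _) _; apply: le_trans (dual_norm_ub _ _) _.
  by rewrite ler_piMl.
have sumG : k.+1%:R * (dual_fun phi (G u) - d / 2)
    <= dual_fun (G u) (\sum_(i < k.+1) x (b i)).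
  rewrite linear_sum /= mulr_natl -[k.+1 in leLHS]card_ord -sumr_const.
  exact: ler_sum.
have Gu : dual_fun (G u) u < k.+1%:R * (dual_fun phi (G u) - d).
  rewrite mulrC -ltr_pdivrMr ?ltr0n//.
  have <- : dual_fun (G u) (k.+1%:R^-1 *: u) = dual_fun (G u) u / k.+1%:R.
    by rewrite linearZ /= mulrC.
  by rewrite ltrBrDr addrC -ltrBrDr.
rewrite linearB/=; lra.
Qed.

End SeparatedSequence.

(** * Alternating sums along a subsequence *)

Lemma infinite_set_enumeration (M : set nat) : infinite_set M ->
  exists2 e : nat -> nat, {homo e : i j / (i < j)%N} & forall i, M (e i).
Proof.
move=> Minf.
have /choice[next nextP] n : exists m, (n < m)%N /\ M m.
  apply: contra_notP Minf => /forallNP nM.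
  apply: (@sub_finite_set _ _ `I_n.+1); last exact: finite_II.
  by move=> m Mm /=; rewrite ltnNge; apply/negP => nm; exact: (nM m).
exists (fun i => iter i.+1 next 0%N) => [|i]; last first.
  by have [] := nextP (iter i next 0%N).
apply: homo_ltn; first exact: ltn_trans.
by move=> i; have [] := nextP (iter i.+1 next 0%N).
Qed.

Lemma sum_alternating (R : realType) (X : normedModType R) (y : nat -> X) k :
  \sum_(i < k.*2) (-1) ^+ i.+1 *: y i = \sum_(j < k) (y j.*2.+1 - y j.*2).
Proof.
elim: k => [|k IH]; first by rewrite !big_ord0.
rewrite doubleS 2!big_ord_recr/= IH [RHS]big_ord_recr/= -addrA; congr (_ + _).
rewrite -(signr_odd _ k.*2.+1) -(signr_odd _ k.*2.+2) /= odd_double /=.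
by rewrite expr0 expr1 scaleN1r scale1r addrC.
Qed.

Lemma exists_ksubset {k} (u : nat -> nat) :
  (forall i, (i.+1 < k)%N -> (u i < u i.+1)%N) ->
  exists n : ksubset k, forall i, tnth n i = u i.
Proof.
move=> uS; have u_sorted : sorted ltn [tuple u i | i < k].
  rewrite /= (_ : [seq _ | i <- _] = mkseq u k); last first.
    by rewrite /mkseq -val_enum_ord -map_comp.
  apply/(sortedP 0%N) => i; rewrite size_mkseq => ik.
  by rewrite !nth_mkseq; [exact: uS | | exact: ltnW].
by exists (KSubset u_sorted) => i; rewrite tnth_mktuple.
Qed.

(** Two strictly interlacing families [a 0 < b 0 < a 1 < b 1 < ...] of [k]
    indices merge into one increasing family [c] of [2 * k] indices, to which
    the alternating Banach-Saks bound applies. *)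
Lemma alternating_subsequence {R : realType} {X : normedModType R} {p C : R}
    (x : nat -> X) (k : nat) :
  alternating_banach_saks_with X p C -> (0 < k)%N -> (forall i, `|x i| <= 1) ->
  exists2 e : nat -> nat, {homo e : i j / (i < j)%N} &
    forall a b : nat -> nat,
      (forall j, (j < k)%N -> (a j < b j)%N) ->
      (forall j, (j.+1 < k)%N -> (b j < a j.+1)%N) ->
      `|\sum_(j < k) x (e (b j)) - \sum_(j < k) x (e (a j))|
        <= C * k.*2%:R `^ p^-1.
Proof.
move=> abs k0 x1; have k20 : (0 < k.*2)%N by rewrite double_gt0.
have [M /infinite_set_enumeration[e e_mono eM] absM] := abs x x1 k.*2 k20.
exists e => // a b ab ba.
pose c i := e (if odd i then b i./2 else a i./2).
have [i ik|n nE] := @exists_ksubset k.*2 c.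
  apply: e_mono => /=; case: ifPn => oi /=.
    by rewrite uphalf_half oi; apply: ba; lia.
  by rewrite uphalf_half (negbTE oi) add0n; apply: ab; lia.
have := absM n; under eq_bigr do rewrite nE.
rewrite (sum_alternating _ _ (x \o c)) -sumrB => cle.
suff -> : \sum_(j < k) (x (e (b j)) - x (e (a j)))
    = \sum_(j < k) ((x \o c) j.*2.+1 - (x \o c) j.*2).
  by apply: cle => i; rewrite nE; exact: eM.
apply: eq_bigr => j _; rewrite /c /= odd_double /=.
by rewrite uphalf_double doubleK.
Qed.

(** * Lipschitz maps on the interlaced graph *)

Lemma interlaceP {k} (n m : ksubset k) : interlace n m ->
  (forall j, (j < k)%N -> (nth 0%N n j <= nth 0%N m j)%N) /\
  (forall j, (j.+1 < k)%N -> (nth 0%N m j <= nth 0%N n j.+1)%N).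
Proof.
move=> /andP[/forallP nm /forallP mn]; split=> j jk.
  by have := nm (Ordinal jk); rewrite !(tnth_nth 0%N).
have /forallP/(_ (Ordinal jk)) := mn (Ordinal (ltnW jk)).
by rewrite !(tnth_nth 0%N) eqxx.
Qed.

Lemma interlaced_distP {k} (n m : ksubset k) : (interlaced_dist n m <= 1)%N ->
  [\/ n = m, interlace n m | interlace m n].
Proof.
rewrite /interlaced_dist; case: ex_minnP => l /asboolP[s [ps <- sl]] _.
rewrite -sl; case: s ps {sl} => [_ _|a [|//]]; first by constructor 1.
by rewrite /= andbT => /andP[_ /orP[nm|mn]] _; [constructor 2|constructor 3].
Qed.

Lemma interlaced_distxx {k} (n : ksubset k) : interlaced_dist n n = 0%N.
Proof.
apply/eqP; rewrite -leqn0 /interlaced_dist; case: ex_minnP => l _; apply.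
by apply/asboolP; exists [::].
Qed.

Lemma interlaced_dist_gt0 {k} (n m : ksubset k) :
  n != m -> (0 < interlaced_dist n m)%N.
Proof.
move=> nm; rewrite /interlaced_dist; case: ex_minnP => -[|//].
move=> /asboolP[s [_ + s0]].
by rewrite (size0nil s0) /= => nmE; rewrite nmE eqxx in nm.
Qed.

Lemma bounded_interlaced_lipschitz {R : realType} {X : normedModType R} {k}
    (f : ksubset k -> X) (B : R) :
  (forall n, `|f n| <= B) -> interlaced_lipschitz f.
Proof.
move=> fB; exists (B + B) => n m.
have [->|nm] := eqVneq n m.
  by rewrite subrr normr0 mulr_ge0// addr_ge0// (le_trans (normr_ge0 (f m))).
apply: le_trans (ler_normB _ _) _; apply: le_trans (lerD (fB n) (fB m)) _.
rewrite ler_peMr ?ler1n ?interlaced_dist_gt0//.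
by rewrite addr_ge0// (le_trans (normr_ge0 (f m))).
Qed.

Lemma modulus1_le {R : realType} {X : normedModType R} {k}
    (f : ksubset k -> X) (B : R) (n0 : ksubset k) : 0 <= B ->
  (forall n m, interlace n m -> `|f n - f m| <= B) -> modulus f 1 <= B.
Proof.
move=> B0 fB; apply: ge_sup.
  exists `|f n0 - f n0|, (n0, n0) => //=.
  by rewrite interlaced_distxx ler01.
move=> _ [[n m] /= nm <-]; rewrite lern1 in nm.
have [->|/fB//|/fB] := interlaced_distP _ _ nm; first by rewrite subrr normr0.
by rewrite distrC.
Qed.

(** The map [f] sums [x] over the even slots [2k * n_j + 2j] of the subsequence
    [e]. For interlaced [n <= m], the odd slots following those of [m] interlace
    strictly with the slots of [n] and with those of [m], and [f n - f m] is
    estimated through the sum [g] over them. *)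
Lemma separation_le {R : realType} {X : normedModType R} {p q C D t : R}
    (x : nat -> X) (k : nat) : (0 < k)%N -> 0 <= C ->
  alternating_banach_saks_with X p C ->
  (forall f : ksubset k -> X, interlaced_lipschitz f ->
    exists2 M : set nat, infinite_set M &
      forall n m : ksubset k, ksubset_of M n -> ksubset_of M m ->
        `|f n - f m| <= D * modulus f 1 * k%:R `^ q^-1) ->
  0 <= D ->
  (forall i, `|x i| <= 1) ->
  (forall a b : 'I_k -> nat, (forall i j, (a i < b j)%N) ->
    t <= `|\sum_(i < k) x (b i) - \sum_(i < k) x (a i)|) ->
  t <= D * (2 * (C * k.*2%:R `^ p^-1)) * k%:R `^ q^-1.
Proof.
move=> k0 C0 abs Q D0 x1 sep.
have [e e_mono eP] := alternating_subsequence x k abs k0 x1.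
set B := C * _ in eP *; have B0 : 0 <= B by rewrite mulr_ge0// powR_ge0.
pose slot (n : ksubset k) j := (k.*2 * nth 0 n j + j.*2)%N.
pose f n := \sum_(j < k) x (e (slot n j)).
have fB n : `|f n| <= k%:R.
  apply: le_trans (ler_norm_sum _ _ _) _.
  apply: (@le_trans _ _ (\sum_(j < k) 1)); first exact: ler_sum.
  by rewrite sumr_const card_ord.
have f_interlace n m : interlace n m -> `|f n - f m| <= 2 * B.
  move=> /interlaceP[nm mn].
  have mS j : (j.+1 < k)%N -> (nth 0 m j < nth 0 m j.+1)%N.
    move=> jk; apply: (sorted_ltn_nth ltn_trans) => //;
      rewrite ?ktuple_sorted// inE size_tuple//.
    exact: ltnW.
  pose g := \sum_(j < k) x (e (slot m j).+1).
  apply: le_trans (ler_distD g _ _) _; rewrite mulr2n mulrDl mul1r.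
  rewrite distrC; apply: lerD; [apply: (eP (slot n) (fun j => (slot m j).+1))
    | apply: (eP (slot m) (fun j => (slot m j).+1))] => j jk.
  - by have := nm j jk; rewrite /slot; nia.
  - by have := mn j jk; rewrite /slot; nia.
  - by [].
  - by have := mS j jk; rewrite /slot; nia.
have [M /infinite_set_enumeration[u u_mono uM] MP] :=
  Q f (bounded_interlaced_lipschitz f _ fB).
have [i _|n nE] := @exists_ksubset k u; first exact: u_mono.
have [i _|m mE] := @exists_ksubset k (fun i => u (k + i)%N).
  by apply: u_mono; rewrite ltn_add2l.
have modB : modulus f 1 <= 2 * B.
  by apply: (modulus1_le f _ n _ f_interlace); rewrite mulr_ge0.
apply: (@le_trans _ _ `|f m - f n|); last first.
  apply: le_trans (MP m n _ _) _; try by move=> i; rewrite ?nE ?mE.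
  by rewrite ler_wpM2r ?powR_ge0// ler_wpM2l.
apply: (sep (fun j => e (slot n j)) (fun j => e (slot m j))) => i j.
apply: e_mono; rewrite /slot.
have := nE i; have := mE j; rewrite !(tnth_nth 0%N) => -> ->.
have : (u i < u (k + j))%N.
  by apply: u_mono; rewrite (leq_trans (ltn_ord i))// leq_addr.
have := ltn_ord i; nia.
Qed.

(** * The exponent comparison *)

Lemma powR_unbounded {R : realType} (s B : R) : 0 < s ->
  exists2 k, (0 < k)%N & B < k%:R `^ s.
Proof.
move=> s0; pose c := `|B| `^ s^-1; have c0 : 0 <= c by exact: powR_ge0.
have cN := archi_boundP c0; exists (Num.bound c).
  by rewrite -(ltr0n R); exact: le_lt_trans cN.
apply: le_lt_trans (ler_norm B) _.
have -> : `|B| = c `^ s by rewrite /c -powRrM mulVf ?lt0r_neq0// powRr1.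
by apply: gt0_ltr_powR; rewrite ?nnegrE.
Qed.

Theorem corollary3p7 (R : realType) (p q : R) (X : completeNormedModType R) :
  1 < p -> 1 < q -> p / (p - 1) < q ->
  alternating_banach_saks X p -> property_Q X q ->
  reflexive_space X.
Proof.
move=> p1 q1 pq [C C0 abs] [D D1 Q] phi.
apply: contrapT => nphi.
have [e e0 ephi] : exists2 e, 0 < e &
    forall x, e <= `|phi - canonical_embedding x|.
  apply: contra_notP nphi => nfar; apply: canonical_embedding_closed => e e0.
  apply: contra_notP nfar => near_phi; exists e => // x.
  by rewrite leNgt; apply/negP => xe; apply: near_phi; exists x.
have [psi psi1 [d d0 dpsi]] : exists2 psi : dual (dual X), `|psi| <= 1 &
    exists2 d, 0 < d & forall x, d < `|psi - canonical_embedding x|.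
  pose c := `|phi| + 1; have c0 : 0 < c by rewrite ltr_wpDl.
  exists (c^-1 *: phi).
    by rewrite normrZ gtr0_norm ?invr_gt0// ler_pdivrMl// mulr1 lerDl.
  exists (c^-1 * (e / 2)) => [|x].
    by rewrite mulr_gt0 ?invr_gt0// divr_gt0.
  have -> : canonical_embedding x = c^-1 *: canonical_embedding (c *: x).
    by rewrite canonical_embeddingZ scalerA mulVf ?lt0r_neq0// scale1r.
  rewrite -scalerBr normrZ gtr0_norm ?invr_gt0// ltr_pM2l ?invr_gt0//.
  by apply: lt_le_trans (ephi _); lra.
have p0 : 0 < p by exact: lt_trans p1.
have q0 : 0 < q by exact: lt_trans q1.
have s0 : 0 < 1 - p^-1 - q^-1.
  rewrite subr_gt0 invf_plt ?posrE// ?subr_gt0 ?invf_lt1//.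
  suff -> : (1 - p^-1)^-1 = p / (p - 1) by [].
  by field; lra.
(* 8 = 2 * 2 * 2: the two alternating sums, the bound 2^(1/p) <= 2, and the
   half of d kept by the separated sequence *)
have [k k0 kE] := powR_unbounded _ (8 * (D * C) / d) s0.
have [x x1 xsep] := exists_separated_sequence psi d k d0 psi1 dpsi.
have := separation_le x k k0 (ltW C0) abs (Q k k0) (le_trans ler01 D1) x1 xsep.
apply/negP; rewrite -ltNge.
have kp : 0 < k%:R `^ p^-1 by rewrite powR_gt0// ltr0n.
have kq : 0 < k%:R `^ q^-1 by rewrite powR_gt0// ltr0n.
have k2p : k.*2%:R `^ p^-1 <= 2 * k%:R `^ p^-1.
  rewrite -muln2 natrM mulrC powRM ?ler0n// ler_pM2r//.
  by apply: ler1_powR; rewrite ?ler1n// invf_le1// ltW.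
have kk : k%:R = k%:R `^ (1 - p^-1 - q^-1) * (k%:R `^ p^-1 * k%:R `^ q^-1).
  rewrite -!powRD ?pnatr_eq0 -?lt0n ?k0 ?implybT//.
  by rewrite (_ : 1 - p^-1 - q^-1 + (p^-1 + q^-1) = 1) ?powRr1//; ring.
rewrite [in ltRHS]kk.
apply: (@le_lt_trans _ _
  (8 * (D * C) / d * (k%:R `^ p^-1 * k%:R `^ q^-1) * (d / 2))).
  have -> : 8 * (D * C) / d * (k%:R `^ p^-1 * k%:R `^ q^-1) * (d / 2)
      = D * (2 * (C * (2 * k%:R `^ p^-1))) * k%:R `^ q^-1.
    by field; lra.
  rewrite ler_pM2r// ler_wpM2l ?(le_trans ler01)// ler_wpM2l//.
  by rewrite ler_wpM2l// ltW.
by rewrite ltr_pM2r ?divr_gt0// ltr_pM2r// mulr_gt0.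
Qed.
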